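(* Let $\alpha$ be a real number. Suppose that the $G_\alpha$-orbit of $0$ or of $\infty$ contains the number $1/2$, that is, for some $X\in G_\alpha$, $X(0)=1/2$ or $X(\infty)=1/2$. Then $\alpha$ is a relation number.
   Context: For $\alpha\in\mathbb{R}$ let $A=\begin{bmatrix}1&1\\0&1\end{bmatrix}$, $B_\alpha=\begin{bmatrix}1&0\\ \alpha&1\end{bmatrix}$, and let $G_\alpha=\langle A,B_\alpha\rangle\subset \mathrm{SL}_2(\mathbb{R})$. The number $\alpha$ is a free number if $G_\alpha$ is isomorphic to the free group of rank $2$; otherwise it is a relation number. The group $G_\alpha$ acts on $\mathbb{R}\cup\{\infty\}$ by Möbius transformations. *)

(* Defs.v *)
From HB Require Import structures.
From mathcomp Require Import all_boot all_order all_algebra.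
From mathcomp Require Import boolp classical_sets functions cardinality reals.

Set Implicit Arguments.
Unset Strict Implicit.
Unset Printing Implicit Defensive.

Import Order.TTheory GRing.Theory Num.Theory.
Local Open Scope ring_scope.
Local Open Scope classical_set_scope.

(* The free group on T, as reduced words: the letter (x, true) stands for the
   generator x and (x, false) for its inverse. *)
Section FreeGroup.
Variable T : choiceType.
Implicit Types (a b : T * bool) (u v w : seq (T * bool)).

Definition letter_inv a : T * bool := (a.1, ~~ a.2).

Definition reduced w : bool := sorted [rel a b | b != letter_inv a] w.

Record free_group := FreeGroup { word : seq (T * bool); _ : reduced word }.

HB.instance Definition _ := [isSub for word].
HB.instance Definition _ := [Choice of free_group by <:].

(* The reduced form of a :: w, when w is reduced. *)
Definition cons_red a w :=
  if w is b :: w' then if b == letter_inv a then w' else a :: w else [:: a].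

(* The reduced form of u ++ v, when v is reduced. *)
Definition cat_red u v := foldr cons_red v u.

Definition word_inv u := rev (map letter_inv u).

Lemma letter_invK : involutive letter_inv.
Proof. by case=> x b; rewrite /letter_inv /= negbK. Qed.

Lemma cons_red_reduced a w : reduced w -> reduced (cons_red a w).
Proof.
case: w => [|b w] //= rw; case: ifPn => [_|ab] /=; last by rewrite ab.
exact: path_sorted rw.
Qed.

Lemma cat_red_reduced u v : reduced v -> reduced (cat_red u v).
Proof. by move=> rv; elim: u => //= a u; apply: cons_red_reduced. Qed.

Lemma cons_redK a w : reduced w -> cons_red a (cons_red (letter_inv a) w) = w.
Proof.
case: w => [|b w] /=; first by rewrite eqxx.
rewrite letter_invK; case: eqVneq => [->|ba] /=; last by rewrite eqxx.
by case: w => [|c w] //= /andP[/negPf ->].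
Qed.

Lemma cat_redA u v w :
  reduced w -> cat_red u (cat_red v w) = cat_red (cat_red u v) w.
Proof.
move=> rw; elim: u => //= a u ->; case: (cat_red u v) => [|b s] //=.
by case: eqP => [->|//] /=; rewrite cons_redK // cat_red_reduced.
Qed.

Lemma cat_reds0 u : reduced u -> cat_red u [::] = u.
Proof.
elim: u => //= a u IHu ru; rewrite IHu; last exact: path_sorted ru.
by case: u ru {IHu} => [|b u] //= /andP[/negPf ->].
Qed.

Lemma word_inv_reduced u : reduced u -> reduced (word_inv u).
Proof.
rewrite /reduced rev_sorted sorted_map; apply: sub_sorted => a b /=.
by rewrite letter_invK eq_sym.
Qed.

Lemma cat_red_inv u v : reduced v -> cat_red (word_inv u) (cat_red u v) = v.
Proof.
move=> rv; elim: u => //= a u {2}<-.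
rewrite /word_inv /= rev_cons /cat_red foldr_rcons.
by rewrite -{2}(letter_invK a) cons_redK // cat_red_reduced.
Qed.

Definition fg_one := @FreeGroup [::] isT.
Definition fg_mul x y :=
  FreeGroup (cat_red_reduced (word x) (valP y : reduced (word y))).
Definition fg_inv x := FreeGroup (word_inv_reduced (valP x : reduced (word x))).

Lemma fg_mulA : associative fg_mul.
Proof. by move=> x y z; apply/val_inj/cat_redA/(valP z). Qed.
Lemma fg_mul1 : left_id fg_one fg_mul.
Proof. by move=> x; apply: val_inj. Qed.
Lemma fg_mulr1 : right_id fg_one fg_mul.
Proof. by move=> x; apply/val_inj/cat_reds0/(valP x). Qed.
Lemma fg_mulV : left_inverse fg_one fg_inv fg_mul.
Proof.
move=> x; apply: val_inj => /=.
by rewrite -{2}(cat_reds0 (valP x)) cat_red_inv.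
Qed.
Lemma fg_mulrV : right_inverse fg_one fg_inv fg_mul.
Proof.
move=> x; rewrite -[LHS]fg_mul1 -{1}(fg_mulV (fg_inv x)) -fg_mulA.
by rewrite (fg_mulA (fg_inv x)) fg_mulV fg_mul1 fg_mulV.
Qed.

HB.instance Definition _ :=
  isGroup.Build free_group fg_mulA fg_mul1 fg_mulr1 fg_mulV fg_mulrV.
End FreeGroup.

Section Subgroups.
Variable G : groupType.
Local Open Scope group_scope.

Definition is_subgroup (H : set G) : Prop :=
  H 1 /\ forall x y, H x -> H y -> H (x / y).

Definition generated_subgroup (S : set G) : set G := smallest is_subgroup S.

Definition isomorphic_to_subgroup (F : groupType) (H : set G) : Prop :=
  exists f : {multiplicative F -> G}, set_bij [set: F] H f.
End Subgroups.

Section SL2.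
Variable R : fieldType.

Record SL2 := MkSL2 { SL2_mx : 'M[R]_2; _ : \det SL2_mx == 1 }.

HB.instance Definition _ := [isSub for SL2_mx].
HB.instance Definition _ := [Choice of SL2 by <:].

Implicit Types X Y : SL2.

Lemma det_SL2 X : \det (SL2_mx X) = 1.
Proof. exact/eqP/(valP X). Qed.

Lemma SL2_unitmx X : SL2_mx X \in unitmx.
Proof. by rewrite unitmxE det_SL2 unitr1. Qed.

Fact SL2_one_subproof : \det (1%:M : 'M[R]_2) == 1.
Proof. by rewrite det1. Qed.
Fact SL2_mul_subproof X Y : \det (SL2_mx X *m SL2_mx Y) == 1.
Proof. by rewrite det_mulmx !det_SL2 mulr1. Qed.
Fact SL2_inv_subproof X : \det (invmx (SL2_mx X)) == 1.
Proof. by rewrite det_inv det_SL2 invr1. Qed.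

Definition SL2_one := MkSL2 SL2_one_subproof.
Definition SL2_mul X Y := MkSL2 (SL2_mul_subproof X Y).
Definition SL2_inv X := MkSL2 (SL2_inv_subproof X).

Lemma SL2_mulA : associative SL2_mul.
Proof. by move=> X Y Z; apply/val_inj/mulmxA. Qed.
Lemma SL2_mul1 : left_id SL2_one SL2_mul.
Proof. by move=> X; apply/val_inj/mul1mx. Qed.
Lemma SL2_mulr1 : right_id SL2_one SL2_mul.
Proof. by move=> X; apply/val_inj/mulmx1. Qed.
Lemma SL2_mulV : left_inverse SL2_one SL2_inv SL2_mul.
Proof. by move=> X; apply/val_inj/mulVmx/SL2_unitmx. Qed.
Lemma SL2_mulrV : right_inverse SL2_one SL2_inv SL2_mul.
Proof. by move=> X; apply/val_inj/mulmxV/SL2_unitmx. Qed.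

HB.instance Definition _ :=
  isGroup.Build SL2 SL2_mulA SL2_mul1 SL2_mulr1 SL2_mulV SL2_mulrV.

(* The projective line is option R, with None as the point at infinity. *)
Definition mobius X (z : option R) : option R :=
  let M := SL2_mx X in
  match z with
  | Some x =>
      let d := M 1 0 * x + M 1 1 in
      if d == 0 then None else Some ((M 0 0 * x + M 0 1) / d)
  | None => if M 1 0 == 0 then None else Some (M 0 0 / M 1 0)
  end.

Definition mobius_orbit (H : set SL2) (z : option R) : set (option R) :=
  [set mobius X z | X in H].

Definition mx2 (a b c d : R) : 'M[R]_2 :=
  \matrix_(i, j) nth 0 (nth [::] [:: [:: a; b]; [:: c; d]] i) j.

Lemma det_mx2 a b c d : \det (mx2 a b c d) = a * d - b * c.
Proof.
rewrite (expand_det_row _ 0) big_ord_recl big_ord1 /cofactor !det_mx11 !mxE /=.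
by rewrite expr0 expr1 mul1r mulN1r mulrN.
Qed.

Fact SL2_A_subproof : \det (mx2 1 1 0 1) == 1.
Proof. by rewrite det_mx2 mulr1 mulr0 subr0. Qed.
Fact SL2_B_subproof alpha : \det (mx2 1 0 alpha 1) == 1.
Proof. by rewrite det_mx2 mulr1 mul0r subr0. Qed.

Definition SL2_A : SL2 := MkSL2 SL2_A_subproof.
Definition SL2_B (alpha : R) : SL2 := MkSL2 (SL2_B_subproof alpha).

Definition G_alpha (alpha : R) : set SL2 :=
  generated_subgroup [set SL2_A; SL2_B alpha].
End SL2.

Definition free_number (R : realType) (alpha : R) : Prop :=
  isomorphic_to_subgroup (free_group 'I_2) (G_alpha alpha).

Definition relation_number (R : realType) (alpha : R) : Prop :=
  ~ free_number alpha.

(* Main.v *)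
(* Let sigma be conjugation by diag(1, -1), an automorphism of G_alpha sending A
   and B to their inverses. If X maps z (0 or infinity) to 1/2, then sigma(X)
   maps z to -1/2 = A^-1(1/2), so w = sigma(X)^-1 A^-1 X fixes z and turns out
   to commute with B (z = 0) or A (z = infinity). Suppose G_alpha is isomorphic
   to the free group F of rank 2. Commuting elements of F are powers of a common
   element c, and A, B generate F / F^2 = (Z/2)^2, in which w equals A because
   sigma acts trivially there.
   - z = 0: B and w are powers of c, so the images of A and B both lie in the
     cyclic subgroup generated by c, which is impossible.
   - z = infinity: A = c^m has m odd, as A is not a square, so w^m is a power of
     A; but w is minus a unipotent matrix, so -1 would be an eigenvalue of a
     power of A.
   The isomorphism need not send the free generators to A and B, which is why
   only properties of generating pairs of F are used. *)
Require Import Defs.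
From HB Require Import structures.
From mathcomp Require Import all_boot all_order all_algebra.
From mathcomp Require Import boolp classical_sets functions cardinality reals.
From mathcomp Require Import zify ring lra.

Set Implicit Arguments.
Unset Strict Implicit.
Unset Printing Implicit Defensive.

Import Order.TTheory GRing.Theory Num.Theory.
Local Open Scope ring_scope.
Local Open Scope classical_set_scope.

(** * Generated subgroups *)

Lemma is_subgroupV (G : groupType) (H : set G) x :
  is_subgroup H -> H x -> H x^-1%g.
Proof. by move=> [H1 HF] Hx; rewrite -div1g; apply: HF. Qed.

Lemma is_subgroupM (G : groupType) (H : set G) x y :
  is_subgroup H -> H x -> H y -> H (x * y)%g.
Proof.
by move=> sH Hx /(is_subgroupV sH) Hy; rewrite -[y]invgK; apply: sH.2.
Qed.

Lemma is_subgroup_generated (G : groupType) (S : set G) :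
  is_subgroup (generated_subgroup S).
Proof.
split=> [H [[H1 _] _] //|x y Gx Gy H sHS].
exact: (sHS.1).2 (Gx _ sHS) (Gy _ sHS).
Qed.

(** Quotients of natural powers stand for integer powers; later only the parity of [p + q], which is
    that of [p - q], matters. *)
Lemma generated_set1P (G : groupType) (c x : G) :
  generated_subgroup [set c] x -> exists p q : nat, x = (c ^+ p / c ^+ q)%g.
Proof.
apply: (@smallest_sub _ _ _ [set x | exists p q : nat, x = c ^+ p / c ^+ q]%g);
  last by move=> _ ->; exists 1, 0; rewrite divg1.
split=> [|_ _ [p [q ->]] [r [s ->]]]; first by exists 0, 0; rewrite divg1.
exists (p + s)%N, (r + q)%N; rewrite !expgnDr !invgM !invgK !mulgA.
congr (_ / _)%g; rewrite -!mulgA; congr (_ * _)%g.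
by apply/commute_sym/commuteV/commuteX2.
Qed.

(** * Word combinatorics and commuting elements of a free group *)

Definition fg_of_seq {T : choiceType} (w : seq (T * bool)) : free_group T :=
  FreeGroup (@cat_red_reduced T w [::] isT).

Lemma fg_of_seqK (T : choiceType) (x : free_group T) : fg_of_seq (word x) = x.
Proof. exact/val_inj/cat_reds0/(valP x). Qed.

Lemma fg_of_seq_cat (T : choiceType) (u v : seq (T * bool)) :
  fg_of_seq (u ++ v) = (fg_of_seq u * fg_of_seq v)%g.
Proof.
by apply: val_inj; rewrite /= [LHS]foldr_cat -[foldr _ _ v]/(cat_red v [::])
  -{1}[cat_red v _]/(cat_red [::] _) -cat_redA ?cat_red_reduced.
Qed.

Lemma fg_of_seqV (T : choiceType) (u : seq (T * bool)) :
  fg_of_seq (word_inv u) = (fg_of_seq u)^-1%g.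
Proof.
apply/invg_inj; rewrite invgK; apply: mulg1_eq; apply: val_inj.
rewrite -fg_of_seq_cat [LHS]foldr_cat; exact: (@cat_red_inv _ u [::] isT).
Qed.

Lemma size_cons_red (T : choiceType) (a : T * bool) w :
  (size (cons_red a w) <= (size w).+1)%N.
Proof. by case: w => //= b w; case: ifP => //= _; lia. Qed.

Lemma size_fg_of_seq (T : choiceType) (w : seq (T * bool)) :
  (size (word (fg_of_seq w)) <= size w)%N.
Proof. by elim: w => //= a w IHw; apply: leq_trans (size_cons_red _ _) _. Qed.

(** As both words are reduced, letters cancel only at their junction, and [s] is the end of [x] that
    cancels. In the induction, a new first letter can cancel only if [u] is empty. *)
Lemma word_mul_split (T : choiceType) (x y : free_group T) :
  exists u s v, [/\ word x = u ++ s, word y = word_inv s ++ v &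
                    word (x * y)%g = u ++ v].
Proof.
have: reduced (word x) by apply: valP.
rewrite [word (x * y)%g]/= ; elim: (word x) => [|a w IHw] rw /=.
  by exists [::], [::], (word y).
have {IHw} [u [s [v [Ew Ey ->]]]] := IHw (path_sorted rw).
case: u Ew => [|b u] /= Ew; last first.
  exists [:: a, b & u], s, v; split; rewrite ?Ew //.
  by move: rw; rewrite Ew /= => /andP[/negPf->].
case: v Ey => [|b v] Ey /=; first by exists [:: a], s, [::]; rewrite Ew.
case: eqP => [Eb|_]; last by exists [:: a], s, (b :: v); rewrite Ew.
exists [::], (a :: s), v; split; rewrite ?Ew //=.
by rewrite Ey Eb /word_inv /= rev_cons cat_rcons.
Qed.

Lemma size_word_inv (T : choiceType) (u : seq (T * bool)) :
  size (word_inv u) = size u.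
Proof. by rewrite size_rev size_map. Qed.

Lemma word_inv_rcons (T : choiceType) (u : seq (T * bool)) a :
  word_inv (rcons u a) = letter_inv a :: word_inv u.
Proof. by rewrite /word_inv map_rcons rev_rcons. Qed.

(** Induction on the total length, with [x] the shorter element. If nothing cancels in [x * y], then
    [y] starts with [x]; if all of [x] cancels, [y] starts with the inverse of [x]; otherwise a
    conjugation shortens both. *)
Lemma fg_commute_root (T : choiceType) (x y : free_group T) : commute x y ->
  exists c, generated_subgroup [set c] x /\ generated_subgroup [set c] y.
Proof.
have [n] := ubnP (size (word x) + size (word y))%N.
elim: n x y => // n IHn x y.
wlog le_xy : x y / (size (word x) <= size (word y))%N => [hwlog|].
  case: (leqP (size (word x)) (size (word y))) => [|/ltnW]; first exact: hwlog.
  rewrite addnC => le_yx lt_n /commute_sym cyx.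
  by have [c []] := hwlog _ _ le_yx lt_n cyx; exists c.
rewrite ltnS => le_n cxy.
have subM c := is_subgroupM (is_subgroup_generated [set c : free_group T]).
have subV c := is_subgroupV (is_subgroup_generated [set c : free_group T]).
have [x1|x_n0] := eqVneq (word x) [::].
  exists y; rewrite -[x]fg_of_seqK x1.
  have -> : fg_of_seq [::] = 1%g :> free_group T by apply: val_inj.
  by split; [apply: (is_subgroup_generated _).1 | apply: sub_gen_smallest].
have size_x : (0 < size (word x))%N by case: (word x) x_n0.
have [u [s [v [Ex Ey Exy]]]] := word_mul_split x y.
have [v' [t [u' [Ey' Ex' Eyx]]]] := word_mul_split y x.
have Euv : u ++ v = v' ++ u' by rewrite -Exy -Eyx cxy.
(* The products [x * y] and [y * x] have the same length, and each cancellation removes twice the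
   cancelled part. *)
have size_st : size s = size t.
  have := congr1 size Euv; have := congr1 size Ex; have := congr1 size Ey.
  have := congr1 size Ex'; have := congr1 size Ey'.
  rewrite !size_cat !size_word_inv; lia.
(* If y starts with the word of x or of x^-1, induct on x and the rest of y. *)
have shorten z w : word y = z ++ w -> (0 < size z)%N ->
    (fg_of_seq z = x \/ fg_of_seq z = x^-1)%g ->
    exists c, generated_subgroup [set c] x /\ generated_subgroup [set c] y.
  move=> Ezw z_gt0 Ez.
  have Dy : y = (fg_of_seq z * fg_of_seq w)%g.
    by rewrite -fg_of_seq_cat -Ezw fg_of_seqK.
  have cxz : commute x (fg_of_seq z).
    by case: Ez => ->; [|apply: commuteV]; apply: commute_refl.
  have [||c [cx cw]] := IHn x (fg_of_seq w).
  - have := size_fg_of_seq w; have := congr1 size Ezw; rewrite size_cat.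
    lia.
  - rewrite -[fg_of_seq w](mulKg (fg_of_seq z)) -Dy.
    by apply: commuteM => //; apply: commuteV.
  exists c; split=> //; rewrite Dy; apply: subM => //.
  by case: Ez => -> //; apply: subV.
case: (eqVneq s [::]) => [s0|s_n0].
  have t0 : t = [::] by case: (t) size_st; rewrite s0.
  move: Ex Ey Ex' Ey' Euv.
  rewrite s0 t0 !cats0 /= => <- <- <- <- Euv.
  apply: (shorten (word x) (drop (size (word x)) (word y))) => //.
    have := congr1 (take (size (word x))) Euv.
    rewrite take_size_cat // takel_cat // => Et.
    by rewrite [X in X ++ _]Et cat_take_drop.
  by rewrite fg_of_seqK; left.
case: u => [|a u] in Ex Exy Euv.
  apply: (shorten (word_inv s) v) => //.
    by rewrite size_word_inv; case: (s) s_n0.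
  by rewrite fg_of_seqV -[s]/([::] ++ s) -Ex fg_of_seqK; right.
(* Partial cancellation in both products: x and y both start with the letter a
   and end with its inverse, so conjugating by a shortens both. *)
have Dv' : exists v'', v' = a :: v''.
  have := congr1 size Ex; have := congr1 size Ey'; rewrite !size_cat /=.
  case: v' Euv {Ey' Eyx} => [|b v'] /=; first by lia.
  by case=> <- _; exists v'.
have [v'' Dv''] := Dv' => {Dv'}.
case/lastP: t => [|t b] in Ey' Ex' size_st.
  by case: (s) size_st s_n0.
case/lastP: s => [|s d] in Ex Ey size_st s_n0 *; first by [].
move: (Ex) (Ey'); rewrite Ex' Ey Dv'' !word_inv_rcons /= => -[ab _] -[da _].
have conj (z : free_group T) m : word z = a :: rcons m (letter_inv a) ->
    z = (fg_of_seq m ^ (fg_of_seq [:: a])^-1)%g /\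
    (size (word (fg_of_seq m)) < size (word z))%N.
  move=> Ez; split; last first.
    by rewrite Ez /= size_rcons ltnS ltnW // ltnS size_fg_of_seq.
  rewrite conjgE invgK -fg_of_seqV -!fg_of_seq_cat /= -[z]fg_of_seqK Ez.
  by rewrite cats1.
have Db : b = letter_inv a by rewrite -ab letter_invK.
have Dd : d = letter_inv a by rewrite -da letter_invK.
have [Dx lt_x] := conj x (u ++ s) ltac:(by rewrite Ex Dd /= rcons_cat).
have [Dy lt_y] := conj y (v'' ++ t) ltac:(by rewrite Ey' Dv'' Db /= rcons_cat).
have [||c [cx cy]] := IHn (fg_of_seq (u ++ s)) (fg_of_seq (v'' ++ t)).
- lia.
- apply: (conjg_inj (fg_of_seq [:: a])^-1%g).
  by rewrite !conjMg -Dx -Dy.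
exists (c ^ (fg_of_seq [:: a])^-1)%g; rewrite Dx Dy; move: cx cy.
have conj_gen z : generated_subgroup [set c] z ->
  generated_subgroup [set c ^ (fg_of_seq [:: a])^-1]%g
    (z ^ (fg_of_seq [:: a])^-1)%g.
  pose g := (fg_of_seq [:: a])^-1%g.
  apply: (@smallest_sub _ _ _
    [set z | generated_subgroup [set c ^ g] (z ^ g)]%g) => [|_ ->];
    last exact: sub_gen_smallest.
  split=> [|z1 z2 /= G1 G2].
    by rewrite /= conj1g; apply: (is_subgroup_generated _).1.
  by rewrite conjMg conjVg; apply: (is_subgroup_generated _).2.
by move=> /conj_gen ? /conj_gen.
Qed.

(** * Homomorphisms from the free group to Z/2 *)

(* The homomorphism to Z/2 sending a generator i to e i. *)
Definition letter_parity (T : choiceType) (e : pred T) (x : free_group T) :=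
  odd (count (fun a => e a.1) (word x)).

Lemma letter_parityM (T : choiceType) (e : pred T) (x y : free_group T) :
  letter_parity e (x * y)%g = letter_parity e x (+) letter_parity e y.
Proof.
have [u [s [v]]] := word_mul_split x y.
rewrite /letter_parity => -[-> -> ->]; rewrite !count_cat !oddD.
have -> : count (fun a => e a.1) (word_inv s) = count (fun a => e a.1) s.
  by rewrite count_rev count_map.
by rewrite -addbA addKb.
Qed.

Lemma letter_parityV (T : choiceType) (e : pred T) (x : free_group T) :
  letter_parity e x^-1%g = letter_parity e x.
Proof.
have := letter_parityM e x^-1%g x; rewrite mulVg -[letter_parity e 1%g]/false.
by do 2!case: letter_parity.
Qed.

Lemma letter_parityX (T : choiceType) (e : pred T) (x : free_group T) n :
  letter_parity e (x ^+ n)%g = odd n && letter_parity e x.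
Proof.
elim: n => // n IHn; rewrite expgS letter_parityM IHn /=.
by case: (odd n); case: letter_parity.
Qed.

Lemma letter_parityF (T : choiceType) (e : pred T) (c : free_group T) p q :
  letter_parity e (c ^+ p / c ^+ q)%g = odd (p + q) && letter_parity e c.
Proof.
by rewrite letter_parityM letter_parityV !letter_parityX oddD -andb_addl.
Qed.

(** The homomorphisms to Z/2 form a plane over the field with two elements, and evaluation at [c] is
    a linear form on it, so its kernel is not zero. Concretely, if both coordinate parities of [c]
    are odd, their sum, given by [predT], is even. *)
Lemma letter_parity_ker2 (c : free_group 'I_2) :
  exists2 e : pred 'I_2, ~ e =1 pred0 & letter_parity e c = false.
Proof.
case E0: (letter_parity (pred1 0) c); last first.
  by exists (pred1 0) => // /(_ 0); rewrite /= eqxx.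
case E1: (letter_parity (pred1 1) c); last first.
  by exists (pred1 1) => // /(_ 1); rewrite /= eqxx.
exists predT; first by move/(_ 0).
rewrite -[RHS]/(true (+) true) -{1}E0 -E1 /letter_parity -oddD.
congr odd; elim: (word c) => //= -[i b] w -> /=.
have: (i == 0) || (i == 1) by case: i => -[|[|[]]].
by case/orP => /eqP-> /=; lia.
Qed.

(** * Two-by-two matrices and the sign-flip automorphism *)

Lemma mx2_eta (R : fieldType) (M : 'M[R]_2) :
  M = mx2 (M 0 0) (M 0 1) (M 1 0) (M 1 1).
Proof.
by apply/matrixP => -[[|[|//]] i] [[|[|//]] j]; rewrite !mxE /=;
  congr (M _ _); apply: val_inj.
Qed.

Lemma mulmx_mx2 (R : fieldType) (a b c d a' b' c' d' : R) :
  mx2 a b c d *m mx2 a' b' c' d' =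
  mx2 (a * a' + b * c') (a * b' + b * d') (c * a' + d * c') (c * b' + d * d').
Proof.
by rewrite [LHS]mx2_eta !mxE !big_ord_recl !big_ord0 !mxE /= !addr0.
Qed.

Lemma SL2_mx_inj (R : fieldType) : injective (@SL2_mx R).
Proof. exact: val_inj. Qed.

Lemma SL2_mxM (R : fieldType) (X Y : SL2 R) :
  SL2_mx (X * Y)%g = SL2_mx X *m SL2_mx Y.
Proof. by []. Qed.

Lemma SL2_mx_exp_eigen (R : fieldType) (X : SL2 R) (v : 'cV[R]_2) (t : R) n :
  SL2_mx X *m v = t *: v -> SL2_mx (X ^+ n)%g *m v = t ^+ n *: v.
Proof.
move=> Xv; elim: n => [|n IHn]; first by rewrite expr0 scale1r mul1mx.
by rewrite expgSr SL2_mxM -mulmxA Xv -scalemxAr IHn scalerA exprS.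
Qed.

Fact SL2_flip_subproof (R : fieldType) (X : SL2 R) (M := SL2_mx X) :
  \det (mx2 (M 0 0) (- M 0 1) (- M 1 0) (M 1 1)) == 1.
Proof. by rewrite det_mx2 mulrNN -det_mx2 -mx2_eta det_SL2. Qed.

(* Conjugation by diag(1, -1). *)
Definition SL2_flip (R : fieldType) (X : SL2 R) := MkSL2 (SL2_flip_subproof X).

Lemma SL2_flipM (R : fieldType) (X Y : SL2 R) :
  SL2_flip (X * Y)%g = (SL2_flip X * SL2_flip Y)%g.
Proof.
apply: val_inj; rewrite /= [SL2_mx X]mx2_eta [SL2_mx Y]mx2_eta.
rewrite !mulmx_mx2 !mxE /=; congr (mx2 _ _ _ _); ring.
Qed.

Lemma SL2_flip1 (R : fieldType) : SL2_flip (1%g : SL2 R) = 1%g.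
Proof.
by apply: val_inj; rewrite [RHS]mx2_eta /= !mxE /= !oppr0.
Qed.

Lemma SL2_flipV (R : fieldType) (X : SL2 R) :
  SL2_flip X^-1%g = (SL2_flip X)^-1%g.
Proof.
by apply/esym/mulg1_eq; rewrite -SL2_flipM mulgV SL2_flip1.
Qed.

Lemma SL2_flipA (R : fieldType) : SL2_flip (SL2_A R) = (SL2_A R)^-1%g.
Proof.
apply/esym/mulg1_eq/val_inj; rewrite /= [RHS]mx2_eta mulmx_mx2 !mxE /=.
by congr (mx2 _ _ _ _); ring.
Qed.

Lemma SL2_flipB (R : fieldType) (alpha : R) :
  SL2_flip (SL2_B alpha) = (SL2_B alpha)^-1%g.
Proof.
apply/esym/mulg1_eq/val_inj; rewrite /= [RHS]mx2_eta mulmx_mx2 !mxE /=.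
by congr (mx2 _ _ _ _); ring.
Qed.

(** * Transfer to the free group *)

(* [{multiplicative G -> H}] only requires compatibility with products. *)
Lemma multiplicative_morphism (G H : groupType) (f : {multiplicative G -> H}) :
  exists g : UMagmaMorphism.type G H, g = f :> (G -> H).
Proof.
have f1 : f 1%g = 1%g by apply: (mulgI (f 1%g)); rewrite -gmulfM !mulg1.
pose fM := isMultiplicative.Build G H f gmulfM.
pose f1M := Multiplicative_isUMagmaMorphism.Build G H f f1.
by exists (HB.pack_for (UMagmaMorphism.type G H) (f : G -> H) fM f1M).
Qed.

Lemma free_number_lift (R : realType) (alpha : R) (X : SL2 R) :
  free_number alpha -> G_alpha alpha X ->
  exists (f : UMagmaMorphism.type (free_group 'I_2) (SL2 R)) a b w,
    [/\ injective f,
        [/\ f a = SL2_A R, f b = SL2_B alpha &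
            SL2_A R * SL2_flip X * f w = X]%g,
        forall e, letter_parity e w = letter_parity e a &
        forall e, letter_parity e a = false -> letter_parity e b = false ->
          e =1 pred0].
Proof.
move=> [f0]; have [f <-] := multiplicative_morphism f0.
move=> [fG f_inj f_surj] GX.
have inj_f : injective f by move=> x y; apply: f_inj; rewrite inE.
have [a _ fa] : (f @` setT) (SL2_A R).
  by apply: f_surj; apply: sub_gen_smallest; left.
have [b _ fb] : (f @` setT) (SL2_B alpha).
  by apply: f_surj; apply: sub_gen_smallest; right.
(* The pairs of preimages are built along the generation of [X]: the flip inverts both generators,
   and inversion preserves parity. *)
have [x [x' [fx fx' xx']]] : exists x x', [/\ f x = X, f x' = SL2_flip X &
    forall e, letter_parity e x' = letter_parity e x].
  apply: (@smallest_sub _ _ _ [set Y | exists y y', [/\ f y = Y,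
    f y' = SL2_flip Y & forall e, letter_parity e y' = letter_parity e y]] _ _
    _ GX) => [|_ [->|->]].
  - split=> /= [|_ _ [x [x' [<- fx' xx']]] [y [y' [<- fy' yy']]]].
      by exists 1%g, 1%g; rewrite SL2_flip1 gmulf1.
    exists (x / y)%g, (x' / y')%g; rewrite SL2_flipM SL2_flipV -fx' -fy' !gmulfF.
    by split=> // e; rewrite !letter_parityM !letter_parityV xx' yy'.
  - exists a, a^-1%g; rewrite gmulfV fa SL2_flipA.
    by split=> // e; rewrite letter_parityV.
  - exists b, b^-1%g; rewrite gmulfV fb SL2_flipB.
    by split=> // e; rewrite letter_parityV.
exists f, a, b, (x'^-1 * a^-1 * x)%g; split=> // [|e|e ea eb i].
- by rewrite -fa -fx' -!gmulfM !mulgA mulgK mulgV mul1g.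
- by rewrite !letter_parityM !letter_parityV xx' addbC addKb.
(* The value [e i] is the parity of the one-letter word [i]. Images of elements of even parity form
   a subgroup containing [SL2_A R] and [SL2_B alpha], hence all of [G_alpha alpha]. *)
have Gi : G_alpha alpha (f (fg_of_seq [:: (i, true)])) by apply: fG.
suff [y /inj_f ->] : [set Y | exists2 y, f y = Y & letter_parity e y = false]
    (f (fg_of_seq [:: (i, true)])).
  by rewrite /letter_parity /=; case: (e i).
apply: (smallest_sub _ _ Gi) => [|_ [->|->]].
- split=> /= [|_ _ [y <- ey] [z <- ez]]; first by exists 1%g; rewrite ?gmulf1.
  by exists (y / z)%g; rewrite ?gmulfF // letter_parityM letter_parityV ey ez.
- by exists a.
- by exists b.
Qed.

(** * The orbits of infinity and of zero *)

Lemma orbit_infty_relation (R : realType) (alpha : R) :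
  mobius_orbit (G_alpha alpha) None (Some (1 / 2)) -> relation_number alpha.
Proof.
move=> [X GX]; rewrite /mobius; case: eqP => // /eqP c_n0 [half] free.
have neqN11 : -1 <> 1 :> R by lra.
have [f [a [b [w [inj_f [fa fb fw] _ gen_ab]]]]] := free_number_lift free GX.
have EX := mx2_eta (SL2_mx X); have := det_SL2 X; rewrite {1}EX det_mx2.
have EX' : SL2_mx (SL2_flip X) = mx2 _ _ _ _ := erefl.
move: c_n0 half EX EX'.
set p := SL2_mx X 0 0; set q := SL2_mx X 0 1.
set r := SL2_mx X 1 0; set s := SL2_mx X 1 1 => r_n0 half EX EX' det1.
have Dr : r = 2 * p by rewrite -[p](divfK r_n0) half; field.
have Dps : p * s = 1 + 2 * (p * q).
  by move/eqP: det1; rewrite Dr subr_eq => /eqP->; ring.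
have {fw} fw : SL2_mx (f w) = mx2 (-1) (2 * q * s - s ^+ 2) 0 (-1).
  (* Multiplying by [SL2_A R * SL2_flip X] on the left avoids inverting matrices. *)
  apply: (can_inj (mulKmx (SL2_unitmx (SL2_A R * SL2_flip X)%g))).
  rewrite -SL2_mxM fw SL2_mxM EX EX' /= !mulmx_mx2 Dr.
  congr (mx2 _ _ _ _); ring: Dps.
have cwa : commute a w.
  apply/inj_f/SL2_mx_inj; rewrite !gmulfM !SL2_mxM fa fw !mulmx_mx2.
  congr (mx2 _ _ _ _); ring.
have [c [/generated_set1P [m [n Da]] /generated_set1P [k [l Dw]]]] :=
  fg_commute_root cwa.
have odd_mn : odd (m + n).
  (* Were [m + n] even, every parity would vanish at [a], so a nonzero one vanishing at [b] would
     vanish at both generators. *)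
  have [e e_n0 e_b] := letter_parity_ker2 b.
  apply: contraT => /negbTE even_mn; case: e_n0; apply: gen_ab => //.
  by rewrite Da letter_parityF even_mn.
(* With [a] the power [m - n] of [c] and [w] the power [k - l], this says that [w] to the [m - n]
   equals [a] to the [k - l], written without inverses. *)
have Dwa : (w ^+ m * a ^+ l = a ^+ k * w ^+ n)%g.
  rewrite Dw Da !expgnFl; try exact: commuteX2.
  rewrite -!expgnA (mulnC l m) (mulnC n k) !mulgA.
  by rewrite -!mulgA !mulKg (mulnC k m) (mulnC n l).
(* A common eigenvector, with eigenvalue 1 for [f a] and -1 for [f w]: applying [Dwa] to it shows
   that [m] and [n] have the same parity, against [odd_mn]. *)
pose e0 : 'cV[R]_2 := delta_mx 0 0.
have aE i : SL2_mx (f a ^+ i)%g *m e0 = e0.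
  rewrite (@SL2_mx_exp_eigen _ _ _ 1) ?expr1n ?scale1r // fa.
  by apply/matrixP => -[[|[|//]] j] i0;
    rewrite (ord1 i0) !mxE !big_ord_recl big_ord0 !mxE /=; ring.
have wE i : SL2_mx (f w ^+ i)%g *m e0 = (-1) ^+ i *: e0.
  apply: SL2_mx_exp_eigen; rewrite fw.
  by apply/matrixP => -[[|[|//]] j] i0;
    rewrite (ord1 i0) !mxE !big_ord_recl big_ord0 !mxE /=; ring.
have := congr1 (fun y => SL2_mx (f y) *m e0) Dwa.
rewrite !gmulfM !gmulfXn !SL2_mxM -!mulmxA aE !wE -scalemxAr aE.
move/(congr1 (fun v : 'cV[R]_2 => v 0 0)); rewrite !mxE /= !mulr1.
rewrite -signr_odd -[RHS]signr_odd; move: odd_mn; rewrite oddD.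
by case: (odd m) (odd n) => -[] //= _; rewrite expr0 expr1 => // /esym.
Qed.

Lemma orbit_zero_relation (R : realType) (alpha : R) :
  mobius_orbit (G_alpha alpha) (Some 0) (Some (1 / 2)) -> relation_number alpha.
Proof.
move=> [X GX]; rewrite /mobius !mulr0 !add0r.
case: eqP => // /eqP s_n0 [half] free.
have [f [a [b [w [inj_f [fa fb fw] par_w gen_ab]]]]] := free_number_lift free GX.
have EX := mx2_eta (SL2_mx X); have := det_SL2 X; rewrite {1}EX det_mx2.
have EX' : SL2_mx (SL2_flip X) = mx2 _ _ _ _ := erefl.
move: s_n0 half EX EX'.
set p := SL2_mx X 0 0; set q := SL2_mx X 0 1.
set r := SL2_mx X 1 0; set s := SL2_mx X 1 1 => s_n0 half EX EX' det1.
(* Here [half] says that X(0) = q / s is 1/2. *)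
have Ds : s = 2 * q by rewrite -[q](divfK s_n0) half; field.
have Dqr : q * r = 2 * (p * q) - 1 by rewrite -[X in _ - X]det1 Ds; ring.
have {fw} fw : SL2_mx (f w) = mx2 1 0 (2 * p * r - r ^+ 2) 1.
  apply: (can_inj (mulKmx (SL2_unitmx (SL2_A R * SL2_flip X)%g))).
  rewrite -SL2_mxM fw SL2_mxM EX EX' /= !mulmx_mx2 Ds.
  congr (mx2 _ _ _ _); ring: Dqr.
have cwb : commute b w.
  apply/inj_f/SL2_mx_inj; rewrite !gmulfM !SL2_mxM fb fw !mulmx_mx2.
  congr (mx2 _ _ _ _); ring.
have [c [/generated_set1P [m [n Db]] /generated_set1P [k [l Dw]]]] :=
  fg_commute_root cwb.
(* A nonzero parity vanishing at [c] vanishes at its powers [b] and [w], and at [a] because [par_w]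
   equates its values at [w] and [a]. *)
have [e e_n0 e_c] := letter_parity_ker2 c; case: e_n0; apply: gen_ab.
  by rewrite -par_w Dw letter_parityF e_c andbF.
by rewrite Db letter_parityF e_c andbF.
Qed.

Theorem proposition5p4 (R : realType) (alpha : R)
    (horbit : mobius_orbit (G_alpha alpha) (Some 0) (Some (1 / 2)) \/
              mobius_orbit (G_alpha alpha) None (Some (1 / 2))) :
  relation_number alpha.
Proof.
by case: horbit => [/orbit_zero_relation|/orbit_infty_relation].
Qed.
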